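(* Let $S_1$ and $S_2$ be two subrings of a finite ring $R$ such that $S_1\subseteq S_2$. Then $\Pr(S_2,R)\le \Pr(S_1,R)\le \Pr(S_1,S_2)$.
   Context: Rings are associative and are not required to have an identity; a subring is an additive subgroup closed under multiplication. For a subring $S$ of a finite ring $T$, $\Pr(S,T)=\dfrac{|\{(s,t)\in S\times T: st=ts\}|}{|S|\,|T|}$. *)

(* Defs.v *)
From HB Require Import structures.
From mathcomp Require Import all_boot all_order all_algebra.

Set Implicit Arguments.
Unset Strict Implicit.
Unset Printing Implicit Defensive.

Import GRing.Theory.
Local Open Scope ring_scope.

(* MathComp's ring structures all carry a unit; the ones here do not.  A unital
   ring is obtained as the special case rng_mul := *%R, and the zero ring is
   allowed. *)
HB.mixin Record Zmodule_isRng R of GRing.Zmodule R := {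
  rng_mul : R -> R -> R;
  rng_mulA : associative rng_mul;
  rng_mulDl : left_distributive rng_mul +%R;
  rng_mulDr : right_distributive rng_mul +%R
}.

#[short(type="finRngType")]
HB.structure Definition FinRng :=
  {R of Zmodule_isRng R & GRing.Zmodule R & Finite R}.

Definition is_subring (R : finRngType) (S : {set R}) : Prop :=
  zmod_closed S /\ {in S &, forall x y, rng_mul x y \in S}.

Definition commuting_pairs (R : finRngType) (S T : {set R}) : {set R * R} :=
  [set p in setX S T | rng_mul p.1 p.2 == rng_mul p.2 p.1].

Definition Pr (R : finRngType) (S T : {set R}) : rat :=
  #|commuting_pairs S T|%:R / (#|S|%:R * #|T|%:R).

(* Main.v *)
Require Import Defs.
From mathcomp Require Import all_boot all_order all_algebra.
From mathcomp Require Import fingroup.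
Local Open Scope ring_scope.

Import GRing.Theory Num.Theory.

(** The probability [Pr S T] is the average over [t] in [T] of the proportion
    of elements of [S] commuting with [t].  These elements form the trace on
    [S] of the centraliser of [t], an additive subgroup of the ring.  Now the
    proportion of an additive group lying in a fixed subgroup [H] can only
    decrease when the group grows ([card_subgroup_capM]): the index
    [A : A :&: H] embeds into [B : B :&: H] when [A] is contained in [B].
    Averaging over [t], [Pr] is antitone in its first argument along inclusions
    of additive subgroups, for any second argument ([Pr_antitone]).

    Being symmetric ([Pr_sym]), it is antitone in its second argument as well.
    Enlarging [S1] to [S2] in the first slot, against the whole ring, gives the
    first inequality; shrinking the whole ring to [S2] in the second slot,
    against [S1], gives the other one. *)

(** By the product formula, the left side is [#|A * (B :&: H)|] times
    [#|A :&: H|], and [A * (B :&: H)] stays inside [B]. *)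
Lemma card_subgroup_capM (gT : finGroupType) (A B H : {group gT}) :
  A \subset B -> (#|A| * #|B :&: H| <= #|A :&: H| * #|B|)%N.
Proof.
move=> sAB; rewrite mul_cardG setIA (setIidPl sAB) mulnC leq_mul2l.
by rewrite subset_leq_card ?orbT // mul_subG ?subsetIl.
Qed.

Lemma zmod_closed_group_set (V : finZmodType) (A : {set V}) :
  zmod_closed A -> group_set A.
Proof.
move=> zA; apply/group_setP; split; first by case: zA.
by move=> x y Ax Ay; case: (GRing.zmod_closedD zA) => _ /(_ x y Ax Ay).
Qed.

Lemma card_zmod_closed_capM (V : finZmodType) (A B H : {set V}) :
    zmod_closed A -> zmod_closed B -> zmod_closed H -> A \subset B ->
  (#|A| * #|B :&: H| <= #|A :&: H| * #|B|)%N.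
Proof.
move=> /zmod_closed_group_set gA /zmod_closed_group_set gB.
move=> /zmod_closed_group_set gH.
exact: (@card_subgroup_capM _ (Group gA) (Group gB) (Group gH)).
Qed.

Section CommutingProbability.

Variable R : finRngType.
Implicit Types (A B S T : {set R}) (t : R).

Definition centraliser t : {set R} := [set x | rng_mul x t == rng_mul t x].

Lemma centraliser_zmod_closed t : zmod_closed (centraliser t).
Proof.
have mulBl : {morph (@rng_mul R)^~ t : x y / x - y}.
  by move=> x y; apply/eqP; rewrite eq_sym subr_eq -rng_mulDl subrK.
have mulBr : {morph rng_mul t : x y / x - y}.
  by move=> x y; apply/eqP; rewrite eq_sym subr_eq -rng_mulDr subrK.
split=> [|x y]; first by rewrite inE -(subrr 0) mulBl mulBr !subrr.
by rewrite !inE mulBl mulBr => /eqP-> /eqP->.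
Qed.

Lemma card_commuting_pairs S T :
  #|commuting_pairs S T| = (\sum_(t in T) #|S :&: centraliser t|)%N.
Proof.
under eq_bigr => t _ do rewrite -sum1_card.
rewrite (exchange_big_dep (mem S)) /=; last by move=> t x _ /setIP[].
rewrite pair_big_dep -sum1_card; apply: eq_bigl => -[x t].
by rewrite !inE /=; case: (x \in S); rewrite ?andbF.
Qed.

Lemma Pr_sym S T : Pr S T = Pr T S.
Proof.
rewrite /Pr [X in _ / X]mulrC; congr (_%:R / _).
have swapK : involutive (fun p : R * R => (p.2, p.1)) by case.
rewrite -(card_preimset _ (inv_inj swapK)); apply: eq_card => -[x y].
by rewrite !inE /= [(x \in T) && _]andbC [rng_mul x y == _]eq_sym.
Qed.

Lemma Pr_antitone A B T : zmod_closed A -> zmod_closed B -> A \subset B ->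
  Pr B T <= Pr A T.
Proof.
move=> zA zB sAB.
have gt0 S : zmod_closed S -> 0 < #|S|%:R :> rat.
  by case=> S0 _; rewrite ltr0n; apply/card_gt0P; exists 0.
rewrite /Pr !invfM !mulrA ler_wpM2r ?invr_ge0 ?ler0n //.
rewrite ler_pdivrMr ?gt0 // mulrAC ler_pdivlMr ?gt0 // -!natrM ler_nat.
rewrite !card_commuting_pairs !big_distrl /=; apply: leq_sum => t _.
by rewrite mulnC card_zmod_closed_capM //; apply: centraliser_zmod_closed.
Qed.

End CommutingProbability.

Theorem theorem2p4 (R : finRngType) (S1 S2 : {set R})
  (hS1 : is_subring S1) (hS2 : is_subring S2) (hS12 : S1 \subset S2) :
  Pr S2 [set: R] <= Pr S1 [set: R] /\ Pr S1 [set: R] <= Pr S1 S2.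
Proof.
case: hS1 hS2 => zS1 _ [zS2 _]; split; first exact: Pr_antitone.
rewrite !(Pr_sym R S1); apply: Pr_antitone (subsetT S2) => //.
by split=> [|x y _ _]; rewrite inE.
Qed.
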